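(* Let $X$ be a finite set and let $d: X\times X\to\mathbb{R}$ be a subtree distance. Then a minimal representation $(\mathcal{T},\phi)$ of $d$ is uniquely determined by $d$ (i.e., any two minimal representations of $d$ coincide up to an isomorphism of weighted trees compatible with the maps $\phi$).
   Context: A weighted tree $\mathcal{T}$ consists of a vertex set $\mathcal{V}(\mathcal{T})$, an edge set $\mathcal{E}(\mathcal{T})$ forming a tree, and nonnegative edge weights $l:\mathcal{E}(\mathcal{T})\to\mathbb{R}_+$; $d_\mathcal{T}(u,v)$ is the weighted shortest-path distance, and for $U,W\subseteq \mathcal{V}(\mathcal{T})$, $d_\mathcal{T}(U,W)=\min\{d_\mathcal{T}(u,w)\mid u\in U,w\in W\}$. A function $d:X\times X\to\mathbb{R}$ is a subtree distance if there exist a weighted tree $\mathcal{T}$ and a map $\phi:X\to 2^{\mathcal{V}(\mathcal{T})}$ such that each $\phi(x)$ induces a connected subgraph (subtree) of $\mathcal{T}$ and $d(x,y)=d_\mathcal{T}(\phi(x),\phi(y))$ for all $x,y\in X$; such a pair $(\mathcal{T},\phi)$ is a representation of $d$. A representation $(\mathcal{T},\phi)$ of $d$ is minimal if there is no representation $(\mathcal{T}',\phi')$ of $d$ such that $\mathcal{T}'$ is a proper minor of $\mathcal{T}$, i.e., obtained from $\mathcal{T}$ by removing some vertices and edges and/or contracting some edges. *)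

(* Defs.v *)
From HB Require Import structures.
From mathcomp Require Import all_boot all_order all_algebra.
From mathcomp Require Import classical_sets reals.

Set Implicit Arguments.
Unset Strict Implicit.
Unset Printing Implicit Defensive.

Import Order.TTheory GRing.Theory Num.Theory.
Local Open Scope ring_scope.

(* Only the values of [weight] on adjacent pairs are meaningful; symmetry makes
   it a function of the undirected edge. The bound [size c <= 2] forbids
   graph-theoretic cycles: [:: u; v] is a closed walk along a single edge. *)
Record weighted_tree (R : realType) := WeightedTree {
  vertex :> finType;
  edge : rel vertex;
  weight : vertex -> vertex -> R;
  edge_sym : symmetric edge;
  edge_irrefl : irreflexive edge;
  tree_nonempty : (0 < #|vertex|)%N;
  tree_connected : forall u v, connect edge u v;
  tree_acyclic : forall c : seq vertex, ucycle edge c -> (size c <= 2)%N;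
  weight_sym : forall u v, edge u v -> weight u v = weight v u;
  weight_ge0 : forall u v, edge u v -> 0 <= weight u v
}.

Arguments edge {R} _ _ _.
Arguments weight {R} _ _ _.

Section Distance.
Variables (R : realType) (T : weighted_tree R).

Fixpoint walk_weight (u : T) (p : seq T) : R :=
  if p is v :: p' then weight T u v + walk_weight v p' else 0.

(* The infimum is a minimum: weights are nonnegative, so some simple path
   is a shortest walk. *)
Definition tree_dist (u v : T) : R :=
  inf [set r | exists p : seq T,
         [/\ path (edge T) u p, last u p = v & r = walk_weight u p]]%classic.

(* For nonempty U and W this is a minimum over a finite nonempty set. *)
Definition set_dist (U W : {set T}) : R :=
  inf [set r | exists u w : T,
         [/\ u \in U, w \in W & r = tree_dist u w]]%classic.

Definition induced_edge (S : {set T}) : rel T :=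
  [rel u v | [&& u \in S, v \in S & edge T u v]].

Definition is_subtree (S : {set T}) : Prop :=
  S != finset.set0 /\ {in S &, forall u v, connect (induced_edge S) u v}.

End Distance.

Definition representation (R : realType) (X : finType) (d : X -> X -> R)
    (T : weighted_tree R) (phi : X -> {set T}) : Prop :=
  (forall x, is_subtree (phi x)) /\
  (forall x y, d x y = set_dist (phi x) (phi y)).

Definition subtree_distance (R : realType) (X : finType) (d : X -> X -> R) : Prop :=
  exists (T : weighted_tree R) (phi : X -> {set T}), representation d phi.

(* T' is (isomorphic to) the graph obtained from T by removing the vertices
   outside W, removing the remaining edges that are not in K, and contracting
   the edges in C. A vertex of T' is a connected component of the graph (W, C),
   and pi names the component of a vertex of W (its values outside W are
   irrelevant). Minors are taken between the underlying unweighted trees: the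
   weights of T and T' are unrelated. *)
Definition minor_by (R : realType) (T T' : weighted_tree R)
    (W : {set T}) (K C : rel T) (pi : T -> T') : Prop :=
  [/\ symmetric K, symmetric C, subrel K (induced_edge W) & subrel C K] /\
  [/\ forall a : T', exists2 u, u \in W & pi u = a,
      {in W &, forall u v, pi u = pi v <-> connect C u v}
    & forall a b : T', edge T' a b <->
        a != b /\ exists u v, [/\ K u v, pi u = a & pi v = b]].

(* Proper: at least one removal or contraction takes place. *)
Definition proper_minor (R : realType) (T' T : weighted_tree R) : Prop :=
  exists (W : {set T}) (K C : rel T) (pi : T -> T'),
    minor_by W K C pi /\
    [\/ exists v, v \notin W,
        exists u v, edge T u v /\ ~~ K u v
      | exists u v, C u v].

Definition minimal_representation (R : realType) (X : finType)
    (d : X -> X -> R) (T : weighted_tree R) (phi : X -> {set T}) : Prop :=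
  representation d phi /\
  ~ exists (T' : weighted_tree R) (phi' : X -> {set T'}),
      representation d phi' /\ proper_minor T' T.

Definition representation_iso (R : realType) (X : finType)
    (T1 T2 : weighted_tree R) (phi1 : X -> {set T1}) (phi2 : X -> {set T2}) : Prop :=
  exists f : T1 -> T2,
    [/\ bijective f,
        forall u v, edge T2 (f u) (f v) = edge T1 u v,
        forall u v, edge T1 u v -> weight T2 (f u) (f v) = weight T1 u v
      & forall x, phi2 x = f @: phi1 x].

(* Main.v *)
(** Write D(t, S) for the distance from a vertex t to a subtree S. In a minimal
    representation every weight is positive and, for every edge tu, some label y
    has phi(y) on the u-side of tu: otherwise one could contract a null edge,
    delete a leaf or suppress a vertex of degree two, all three being the
    contraction of an edge tu where the distance on the vertices other than t is
    kept. Hence a vertex t is determined by its profile z |-> D(t, phi(z)), and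
    d(s, t) is the largest difference between the profiles of s and t.

    The profile in turn depends on d only: if no branch at t meets both phi(x) and
    phi(y), then D(t, phi(z)) is the maximum of 0, d(x, z) - D(t, phi(x)) and
    d(y, z) - D(t, phi(y)). Such labels exist at every vertex t. Either t lies on the
    boundary of some phi(x); then one takes y beyond the boundary edge, and t is
    the end in phi(x) of the bridge from phi(x) to phi(y). Or t has three branches;
    then one takes labels x, y, z inside them, and D(t, phi(x)), D(t, phi(y)) are
    Gromov products. Both configurations can be found again in every other
    representation with positive weights, so the two trees have the same profiles
    and matching them is the isomorphism. *)

Require Import Defs.
From mathcomp Require Import all_boot all_order all_algebra.
From mathcomp Require Import classical_sets reals.
From mathcomp Require Import fintype finset lra.

Set Implicit Arguments.
Unset Strict Implicit.
Unset Printing Implicit Defensive.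

Import Order.TTheory GRing.Theory Num.Theory.
Local Open Scope ring_scope.

(** The first entry into [A] along a path from [a] to [b]; it locates the edges where connected sets
    pass from one branch to another. *)
Lemma connect_crossing (T : finType) (e : rel T) (A : {set T}) (a b : T) :
  connect e a b -> a \notin A -> b \in A ->
  exists c d, [/\ connect e a c, e c d, c \notin A & d \in A].
Proof.
case/connectP => p; elim: p a => [|c p IHp] a /=.
  by move=> _ -> /negP.
case/andP=> eac pcp eb aNA bA; have [cA|cNA] := boolP (c \in A).
  by exists a, c.
have [x [y [cx exy xA yA]]] := IHp c pcp eb cNA bA.
by exists x, y; split=> //; apply: connect_trans (connect1 eac) cx.
Qed.

(** * Walks and the tree metric *)

Section TreeDist.
Variables (R : realType) (T : weighted_tree R).
Implicit Types (u v w s t : T) (U W S : {set T}).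

Lemma walk_weight_ge0 u (p : seq T) : path (edge T) u p -> 0 <= walk_weight u p.
Proof.
elim: p u => [|v p IHp] u //= /andP[uv vp].
by rewrite addr_ge0 ?weight_ge0 ?IHp.
Qed.

Lemma walk_weight_cat u (p q : seq T) :
  walk_weight u (p ++ q) = walk_weight u p + walk_weight (last u p) q.
Proof. by elim: p u => [|v p IHp] u /=; rewrite ?add0r // IHp addrA. Qed.

Lemma tree_dist_le u (p : seq T) :
  path (edge T) u p -> tree_dist u (last u p) <= walk_weight u p.
Proof.
move=> up; apply: ge_inf; last by exists p.
by exists 0 => _ [q [uq _ ->]]; apply: walk_weight_ge0.
Qed.

Lemma tree_dist_ge u v (r : R) :
  (forall p, path (edge T) u p -> last u p = v -> r <= walk_weight u p) ->
  r <= tree_dist u v.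
Proof.
move=> rP; apply: lb_le_inf => [|_ [p [up ulast ->]]]; last exact: rP.
have /connectP[p up ->] := tree_connected u v.
by exists (walk_weight u p), p.
Qed.

Lemma tree_dist_ge0 u v : 0 <= tree_dist u v.
Proof. by apply: tree_dist_ge => p /walk_weight_ge0. Qed.

Lemma tree_dist0 u : tree_dist u u = 0.
Proof. by apply/eqP; rewrite eq_le tree_dist_ge0 (@tree_dist_le u [::]). Qed.

Lemma tree_dist_triangle u v w : tree_dist u w <= tree_dist u v + tree_dist v w.
Proof.
rewrite -lerBlDr; apply: tree_dist_ge => p up uv; rewrite lerBlDr -lerBlDl.
apply: tree_dist_ge => q vq vw; rewrite lerBlDl.
move: vq vw; rewrite -uv -last_cat => vq <-; rewrite -walk_weight_cat.
by apply: tree_dist_le; rewrite cat_path up.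
Qed.

(** Walks are reversed one edge at a time through the triangle inequality, without forming the
    reversed list. *)
Lemma tree_distC u v : tree_dist u v = tree_dist v u.
Proof.
suff le (a b : T) : tree_dist a b <= tree_dist b a by apply/eqP; rewrite eq_le !le.
apply: tree_dist_ge => p; elim: p b => [|c p IHp] b /=.
  by move=> _ ->; rewrite tree_dist0.
case/andP=> bc cp pa; apply: le_trans (tree_dist_triangle a c b) _.
rewrite addrC lerD ?IHp // weight_sym // -[weight T c b]addr0.
by apply: (@tree_dist_le c [:: b]); rewrite /= edge_sym bc.
Qed.

Lemma tree_dist_edge_le u v : edge T u v -> tree_dist u v <= weight T u v.
Proof.
by move=> uv; rewrite -[weight T u v]addr0 (@tree_dist_le u [:: v]) //= uv.
Qed.

(** * Branches: the two sides of an edge *)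

Definition cut_edge t u : rel T :=
  fun a b => edge T a b && ((a, b) \notin [:: (t, u); (u, t)]).
Arguments cut_edge t u a b /.

(* The side of [u] in the tree cut at the edge [t u]. *)
Definition branch t u : {set T} := [set w | connect (cut_edge t u) u w].

Lemma branch_refl t u : u \in branch t u.
Proof. by rewrite inE connect0. Qed.

(** A simple path from [u] to [t] closes up with [tu] to a cycle; acyclicity leaves only the path
    along [tu] itself, which is cut. *)
Lemma branch_root t u : edge T t u -> t \notin branch t u.
Proof.
move=> tu; rewrite inE; apply/negP => /connectP[p up tE].
case: (shortenP up) tE => q uq qU _ tE.
have : (size (u :: q) <= 2)%N.
  apply: (@tree_acyclic _ T); rewrite /ucycle qU /= rcons_path -tE tu !andbT.
  by apply: (sub_path _ uq) => a b /andP[].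
case: q uq qU tE => [|v [|? ?]] //= uq _ tE; first by rewrite tE edge_irrefl in tu.
by move: uq; rewrite -tE /= !inE eqxx !orbT andbF.
Qed.

(** Any edge other than [tu] survives the cut, so it cannot leave the component of [u]. *)
Lemma branch_crossing t u a b : edge T t u -> edge T a b ->
  a \in branch t u -> b \notin branch t u -> a = u /\ b = t.
Proof.
move=> tu ab aB bNB; have [|] := boolP ((a, b) \in [:: (t, u); (u, t)]).
  rewrite !inE => /orP[|] /eqP[aE bE] //.
  by rewrite bE branch_refl in bNB.
move=> abN; case/negP: bNB; move: aB; rewrite !inE => /connect_trans; apply.
by apply: connect1; rewrite /= ab.
Qed.

Lemma cut_edge_sym t u : symmetric (cut_edge t u).
Proof.
move=> a b /=; rewrite edge_sym !inE !xpair_eqE orbC.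
by rewrite [(a == u) && _]andbC [(a == t) && _]andbC.
Qed.

Lemma cut_edgeC t u : cut_edge u t =2 cut_edge t u.
Proof. by move=> a b /=; rewrite !inE orbC. Qed.

(** A common vertex of both sides would join [u] to [t] off the edge [tu]. An edge leaving their
    union would leave one side, hence be [tu], whose ends both lie in the union. *)
Lemma branch_swap t u : edge T t u -> branch u t = ~: branch t u.
Proof.
move=> tu; have ut : edge T u t by rewrite edge_sym.
apply/setP => w; rewrite in_setC; apply/idP/idP => [|wNB].
  apply: contraTN => wB; apply/negP => wB'; case/negP: (branch_root tu).
  move: wB wB'; rewrite !inE (eq_connect (cut_edgeC t u)) => uw tw.
  by rewrite (connect_trans uw) // (sym_connect_sym (cut_edge_sym t u)).
apply/negP => /negP wNB'.
have [||c [d []]] := @connect_crossing _ _ (~: (branch t u :|: branch u t))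
  _ _ (tree_connected t w); rewrite ?in_setC ?in_setU ?branch_refl ?orbT //.
  by rewrite negb_or wNB.
move=> _ cd; rewrite negbK negb_or => /orP[] cB /andP[dB dB'].
  by have [_ dE] := branch_crossing tu cd cB dB; rewrite dE branch_refl in dB'.
by have [_ dE] := branch_crossing ut cd cB dB'; rewrite dE branch_refl in dB.
Qed.

(** The vertex [t] together with its branches is closed under adjacency, so by connectedness it is
    the whole tree. *)
Lemma branch_ex t s : s != t -> exists2 v, edge T t v & s \in branch t v.
Proof.
move=> st; pose A := [set w | [exists v, edge T t v && (w \in branch t v)]].
suff : s \in A by rewrite inE => /existsP[v /andP[tv sv]]; exists v.
apply/negP => /negP sNA.
have [||c [d []]] := @connect_crossing _ _ (~: (t |: A)) _ _ (tree_connected t s).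
- by rewrite in_setC setU11.
- by rewrite in_setC in_setU1 negb_or st.
move=> _ cd; rewrite !in_setC negbK !in_setU1 negb_or => /orP[/eqP cE|].
  case/andP=> _ /negP[]; rewrite inE; apply/existsP; exists d.
  by rewrite -cE cd branch_refl.
rewrite inE => /existsP[v /andP[tv cv]] /andP[/eqP dt dNA]; apply: dt.
apply: (proj2 (branch_crossing tv cd cv _)); apply: contra dNA => dv.
by rewrite inE; apply/existsP; exists v; rewrite tv.
Qed.

(** Otherwise a path inside [branch t v] from [v] to [w] would enter [branch t u] by its only
    entrance, the edge [tu], and so pass through [t]. *)
Lemma branch_uniq t u v w : edge T t u -> edge T t v ->
  w \in branch t u -> w \in branch t v -> u = v.
Proof.
move=> tu tv wu wv; apply/eqP/negP => /negP uv.
have vNu : v \notin branch t u.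
  have vt : edge T v t by rewrite edge_sym.
  apply: contra uv => vu.
  by have [-> _] := branch_crossing tu vt vu (branch_root tu).
move: wv; rewrite inE => /connect_crossing/(_ vNu wu)[c [d [vc]]].
case/andP; rewrite edge_sym => dc _ cNu du.
have [_ cE] := branch_crossing tu dc du cNu.
by case/negP: (branch_root tv); rewrite inE -[X in connect _ _ X]cE.
Qed.

(** Makes the size of a branch a measure for induction away from [t]. *)
Lemma branch_proper t u v : edge T t u -> edge T u v -> v != t ->
  branch u v \proper branch t u.
Proof.
move=> tu uv vt; rewrite properE; apply/andP; split; last first.
  by apply/subsetPn; exists u; rewrite ?branch_refl ?branch_root.
apply/subsetP => w wv; apply/negP => /negP wNu; case/eqP: vt.
apply: (@branch_uniq u v t w) => //; first by rewrite edge_sym.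
by rewrite branch_swap // in_setC.
Qed.

(** Every walk from [s] to [w] has to use the edge [tu]: this is its first step into
    [branch t u]. *)
Lemma tree_dist_cut t u s w : edge T t u -> s \in branch u t ->
  w \in branch t u -> tree_dist s w = tree_dist s t + weight T t u + tree_dist u w.
Proof.
move=> tu; rewrite branch_swap // in_setC => sB wB; apply/eqP; rewrite eq_le.
rewrite (le_trans (tree_dist_triangle s t w)) -?addrA ?lerD2l; last first.
  apply: le_trans (tree_dist_triangle t u w) _.
  by rewrite lerD2r tree_dist_edge_le.
apply: tree_dist_ge => p; elim: p s sB => [|c p IHp] s sB /=.
  by move=> _ sw; rewrite sw wB in sB.
case/andP=> sc cp wE; have [cB|cB] := boolP (c \in branch t u).
  have cs : edge T c s by rewrite edge_sym.
  have [cE sE] := branch_crossing tu cs cB sB; rewrite cE sE in cp wE *.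
  by rewrite tree_dist0 add0r lerD2l -wE tree_dist_le.
apply: le_trans (_ : (weight T s c + tree_dist c t) +
  (weight T t u + tree_dist u w) <= _).
  rewrite lerD2r; apply: le_trans (tree_dist_triangle s c t) _.
  by rewrite lerD2r tree_dist_edge_le.
by rewrite -addrA lerD2l IHp.
Qed.

Lemma tree_dist_edge t u : edge T t u -> tree_dist t u = weight T t u.
Proof.
move=> tu; rewrite (@tree_dist_cut t u) ?branch_refl //.
by rewrite !tree_dist0 addr0 add0r.
Qed.

(** A connected set that avoids [t] cannot change branches, since every edge out of a branch at [t]
    ends in [t]. *)
Lemma subtree_branch S t : is_subtree S -> t \notin S ->
  exists2 u, edge T t u & S \subset branch t u.
Proof.
case=> /set0Pn[s sS] Sc tS; have st : s != t by apply: contraNneq tS => <-.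
have [u tu su] := branch_ex st; exists u => //; apply/subsetP => s' s'S.
apply/negP => /negP s'B.
have [||c [d [_]]] := @connect_crossing _ _ (~: branch t u) _ _ (Sc s s' sS s'S).
- by rewrite in_setC su.
- by rewrite in_setC.
case/and3P=> _ dS cd; rewrite !in_setC negbK => cB dB.
by have [_ dE] := branch_crossing tu cd cB dB; rewrite dE (negPf tS) in dS.
Qed.

Lemma subtree_side S t u s : is_subtree S -> edge T t u -> u \notin S ->
  s \in S -> s \in branch u t -> S \subset branch u t.
Proof.
move=> ST tu uS sS sB; have [v uv Sv] := subtree_branch ST uS.
rewrite (@branch_uniq u t v s) //; last exact: subsetP Sv s sS.
by rewrite edge_sym.
Qed.

(** * Distances between sets of vertices *)

Lemma set_dist_le U W u w : u \in U -> w \in W -> set_dist U W <= tree_dist u w.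
Proof.
move=> uU wW; apply: ge_inf; last by exists u, w.
by exists 0 => _ [a [b [_ _ ->]]]; apply: tree_dist_ge0.
Qed.

Lemma set_dist_attained U W : U != finset.set0 -> W != finset.set0 ->
  exists u w, [/\ u \in U, w \in W & set_dist U W = tree_dist u w].
Proof.
case/set0Pn=> u0 u0U /set0Pn[w0 w0W].
have : (u0, w0) \in finset.setX U W by rewrite in_setX u0U.
case/(arg_minP (fun p => tree_dist p.1 p.2)) => -[u w] /setXP[uU wW] /= uwP.
exists u, w; split=> //.
apply/eqP; rewrite eq_le set_dist_le //=; apply: lb_le_inf.
  by exists (tree_dist u w), u, w.
by move=> _ [a [b [aU bW ->]]]; apply: (uwP (a, b)); apply/setXP.
Qed.

Lemma set_distC U W : set_dist U W = set_dist W U.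
Proof.
by rewrite /set_dist; congr inf; apply/seteqP; split=> _ [a [b [aU bW ->]]];
  exists b, a; rewrite tree_distC.
Qed.

(** This is D(t, W); being the distance from a singleton, it inherits the facts on [set_dist]. *)
Definition point_dist t W := set_dist [set t] W.

Lemma point_dist_le t W w : w \in W -> point_dist t W <= tree_dist t w.
Proof. by apply: set_dist_le; rewrite in_set1. Qed.

Lemma point_dist_attained t W : W != finset.set0 ->
  exists2 w, w \in W & point_dist t W = tree_dist t w.
Proof.
move=> W0; have [|a [w [/set1P-> wW eq]]] := @set_dist_attained [set t] W _ W0.
  by apply/set0Pn; exists t; rewrite in_set1.
by exists w.
Qed.

Lemma point_dist_ge0 t W : W != finset.set0 -> 0 <= point_dist t W.
Proof. by case/(point_dist_attained t) => w _ ->; apply: tree_dist_ge0. Qed.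

Lemma point_dist_in t W : t \in W -> point_dist t W = 0.
Proof.
move=> tW; apply/eqP; rewrite eq_le point_dist_ge0 ?andbT.
  by rewrite -(tree_dist0 t) point_dist_le.
by apply/set0Pn; exists t.
Qed.

Lemma point_dist_triangle s t W : W != finset.set0 ->
  point_dist s W <= tree_dist s t + point_dist t W.
Proof.
case/(point_dist_attained t) => w wW ->.
by apply: le_trans (point_dist_le s wW) (tree_dist_triangle _ _ _).
Qed.

Lemma set_dist_triangle t U W : U != finset.set0 -> W != finset.set0 ->
  set_dist U W <= point_dist t U + point_dist t W.
Proof.
case/(point_dist_attained t) => u uU -> /(point_dist_attained t)[w wW ->].
apply: le_trans (set_dist_le uU wW) _.
by rewrite (tree_distC t u) tree_dist_triangle.
Qed.

Lemma set_dist_cut t u U W : edge T t u ->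
  U != finset.set0 -> W != finset.set0 ->
  U \subset branch u t -> W \subset branch t u ->
  set_dist U W = point_dist t U + weight T t u + point_dist u W.
Proof.
move=> tu U0 W0 UB WB; apply/eqP; rewrite eq_le; apply/andP; split.
  have [x xU ->] := point_dist_attained t U0.
  have [w wW ->] := point_dist_attained u W0.
  apply: le_trans (set_dist_le xU wW) _.
  by rewrite (@tree_dist_cut t u) ?(subsetP UB) ?(subsetP WB) // (tree_distC x).
have [x [w [xU wW ->]]] := set_dist_attained U0 W0.
rewrite (@tree_dist_cut t u) ?(subsetP UB) ?(subsetP WB) //.
by rewrite !lerD ?point_dist_le // tree_distC point_dist_le.
Qed.

Lemma point_dist_cut t u W : edge T t u -> W != finset.set0 ->
  W \subset branch t u -> point_dist t W = weight T t u + point_dist u W.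
Proof.
move=> tu W0 WB; rewrite {1}/point_dist (@set_dist_cut t u) //.
- by rewrite point_dist_in ?in_set1 // add0r.
- by apply/set0Pn; exists t; rewrite in_set1.
- by rewrite sub1set branch_refl.
Qed.

Lemma set_dist_through t u U W : edge T t u ->
  U != finset.set0 -> W != finset.set0 ->
  U \subset branch u t -> W \subset branch t u ->
  set_dist U W = point_dist t U + point_dist t W.
Proof.
by move=> tu U0 W0 UB WB; rewrite (@set_dist_cut t u) // (@point_dist_cut t u W) // addrA.
Qed.

End TreeDist.

(** * Contracting an edge of a tree *)

Lemma connect_map (S S' : finType) (e : rel S) (e' : rel S') (f : S -> S') :
  (forall a b, e a b -> f a = f b \/ e' (f a) (f b)) ->
  forall a b, connect e a b -> connect e' (f a) (f b).
Proof.
move=> ef a b /connectP[p]; elim: p a => [|c p IHp] a /= => [_ ->|].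
  exact: connect0.
case/andP=> /ef eac cp bE; apply: connect_trans (IHp c cp bE).
by case: eac => [->|/connect1].
Qed.

(** A cycle starting with the edge [ab] leaves [A] there and can return to [a] only across the same
    edge; so its last vertex is [b] and its length is two. *)
Lemma acyclic_of_bridges (S : finType) (e : rel S) : symmetric e ->
  (forall a b, e a b -> exists A : {set S}, [/\ a \in A, b \notin A &
     forall c d, e c d -> c \in A -> d \notin A -> c = a /\ d = b]) ->
  forall c, ucycle e c -> (size c <= 2)%N.
Proof.
move=> eC bridge [|a [|b p]] //; rewrite /ucycle /=.
rewrite rcons_path => /andP[/andP[eab /andP[bp la]]].
rewrite inE negb_or => /and3P[/andP[_ aNp] bNp _].
have [A [aA bNA cross]] := bridge a b eab.
have stay q x : path e x q -> x \notin A -> a \notin q -> last x q \notin A.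
  elim: q x => //= y q IHq x /andP[xy yq] xNA.
  rewrite inE negb_or => /andP[ay]; apply: IHq => //; apply/negP => yA.
  have yx : e y x by rewrite eC.
  by case: (cross y x yx yA xNA) => /eqP; rewrite eq_sym (negPf ay).
have lNA := stay p b bp bNA aNp.
have al : e a (last b p) by rewrite eC.
have [_ lb] := cross _ _ al aA lNA.
case: p bNp lb {la bp aNp stay lNA al} => //= c p bNp lb.
by case/negP: bNp; rewrite -[X in X \in _]lb mem_last.
Qed.

Section Contraction.
Variables (R : realType) (T : weighted_tree R) (t u : T).
Hypothesis tu : edge T t u.

Lemma contraction_root : u != t.
Proof. by apply: contraTneq tu => ->; rewrite edge_irrefl. Qed.

(** The merged vertex is represented by [u], so the contraction lives on the vertices other than
    [t]. *)
Definition contr_vertex := {v : T | v != t}.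

Definition contr (v : T) : contr_vertex := insubd (Sub u contraction_root) v.

Lemma val_contr v : val (contr v) = if v == t then u else v.
Proof. by rewrite val_insubd; case: eqP. Qed.

Lemma contr_val (a : contr_vertex) : contr (val a) = a.
Proof. exact: valKd. Qed.

Lemma contr_root : contr t = contr u.
Proof. by apply: val_inj; rewrite !val_contr eqxx (negPf contraction_root). Qed.

Lemma contr_eq v w : contr v = contr w ->
  v = w \/ (v, w) \in [:: (t, u); (u, t)].
Proof.
move/(congr1 val); rewrite !val_contr !inE !xpair_eqE.
have [->|vt] := eqVneq v t; have [->|wt] := eqVneq w t => E; rewrite -?E; auto.
- by right; rewrite !eqxx.
- by right; rewrite E !eqxx orbT.
Qed.

Definition contr_edge (a b : contr_vertex) :=
  (a != b) && [exists v, exists w, [&& edge T v w, contr v == a & contr w == b]].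

Lemma contr_edgeP a b : reflect
  (a != b /\ exists v w, [/\ edge T v w, contr v = a & contr w = b])
  (contr_edge a b).
Proof.
apply: (iffP andP) => -[ab].
  by case/existsP=> v /existsP[w /and3P[vw /eqP va /eqP wb]]; split=> //; exists v, w.
case=> v [w [vw va wb]]; split=> //; apply/existsP; exists v; apply/existsP.
by exists w; rewrite vw va wb !eqxx.
Qed.

Lemma contr_edge_contr v w : edge T v w -> contr v != contr w ->
  contr_edge (contr v) (contr w).
Proof. by move=> vw cvw; apply/contr_edgeP; split=> //; exists v, w. Qed.

Lemma contr_edge_sym : symmetric contr_edge.
Proof.
suff le a b : contr_edge a b -> contr_edge b a by move=> a b; apply/idP/idP => /le.
case/contr_edgeP=> ab [v [w [vw va wb]]]; apply/contr_edgeP.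
by rewrite eq_sym; split=> //; exists w, v; rewrite edge_sym.
Qed.

Lemma contr_edge_irrefl : irreflexive contr_edge.
Proof. by move=> a; rewrite /contr_edge eqxx. Qed.

Lemma contr_nonempty : (0 < #|{: contr_vertex}|)%N.
Proof. by apply/card_gt0P; exists (contr u). Qed.

Lemma contr_connected a b : connect contr_edge a b.
Proof.
rewrite -(contr_val a) -(contr_val b).
apply: (connect_map _ (tree_connected (val a) (val b))) => v w vw.
by have [|/(contr_edge_contr vw)] := eqVneq (contr v) (contr w); auto.
Qed.

(** The ends of the contracted edge lie on the same side of any other edge, so [contr] respects the
    two sides. *)
Lemma branch_contr v w x : edge T v w -> contr v != contr w ->
  (val (contr x) \in branch w v) = (x \in branch w v).
Proof.
move=> vw cvw; have wv : edge T w v by rewrite edge_sym.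
rewrite val_contr; have [->|//] := eqVneq x t.
apply/idP/idP; apply: contraLR => yB; apply/negP => xB.
  have [|uE tE] := branch_crossing wv _ xB yB; first by rewrite edge_sym.
  by case/eqP: cvw; rewrite -uE -tE contr_root.
have [tE uE] := branch_crossing wv tu xB yB.
by case/eqP: cvw; rewrite -uE -tE contr_root.
Qed.

Lemma contr_acyclic (c : seq contr_vertex) :
  ucycle contr_edge c -> (size c <= 2)%N.
Proof.
apply: acyclic_of_bridges c => [|a b]; first exact: contr_edge_sym.
case/contr_edgeP=> ab [v [w [vw va wb]]].
have wv : edge T w v by rewrite edge_sym.
have cvw : contr v != contr w by rewrite va wb.
exists [set x | val x \in branch w v]; split.
- by rewrite inE -va branch_contr // branch_refl.
- by rewrite inE -wb branch_contr // branch_root.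
move=> x y /contr_edgeP[_ [x' [y' [xy <- <-]]]].
rewrite inE branch_contr // => xB; rewrite inE branch_contr // => yB.
by have [-> ->] := branch_crossing wv xy xB yB.
Qed.

(** Neighbours of [t] become neighbours of [u]. Taking distances of [T] as weights treats these new
    edges and the old ones alike. *)
Definition contr_tree : weighted_tree R :=
  @WeightedTree R {: contr_vertex} contr_edge
    (fun a b => tree_dist (val a) (val b))
    contr_edge_sym contr_edge_irrefl contr_nonempty contr_connected contr_acyclic
    (fun a b _ => tree_distC (val a) (val b))
    (fun a b _ => tree_dist_ge0 (val a) (val b)).

Let contrT : T -> contr_tree := contr.

Lemma contr_minor : proper_minor contr_tree T.
Proof.
exists [set: T], (edge T), (fun a b => (a, b) \in [:: (t, u); (u, t)]), contr.
split; last first.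
  by apply: Or33; exists t, u; rewrite !inE eqxx.
split; split.
- exact: edge_sym.
- by move=> a b; rewrite !inE !xpair_eqE orbC; congr (_ || _); rewrite andbC.
- by move=> a b ab; rewrite /induced_edge /= !inE.
- by move=> a b; rewrite !inE => /orP[] /eqP[-> ->] //; rewrite edge_sym.
- by move=> a; exists (val a); rewrite ?inE ?contr_val.
- move=> v w _ _; split=> [/contr_eq[->|vw]|].
  + exact: connect0.
  + exact: connect1.
  case/connectP=> p; elim: p v => [|x p IHp] v /=; first by move=> _ ->.
  case/andP=> vx xp wE; rewrite -(IHp x xp wE).
  by move: vx; rewrite !inE => /orP[] /eqP[-> ->]; rewrite contr_root.
- by move=> a b; split=> /contr_edgeP.
Qed.

(** Either [tu] has weight zero, or [t] has at most one neighbour besides [u]: a leaf or a vertex of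
    degree two. *)
Hypothesis tu_weight : forall v w, edge T t v -> edge T t w ->
  v != u -> w != u -> v != w -> weight T t u = 0.

Lemma contr_dist_edge v w : edge T v w ->
  tree_dist (contrT v) (contrT w) <= tree_dist (val (contr v)) (val (contr w)).
Proof.
move=> vw; have [vwE|vwN] := eqVneq (contrT v) (contrT w).
  by rewrite vwE tree_dist0 tree_dist_ge0.
by apply: tree_dist_edge_le; apply: contr_edge_contr.
Qed.

Lemma neighbor_neq v : edge T t v -> v == t = false.
Proof. by move=> tv; apply: contraTF tv => /eqP->; rewrite edge_irrefl. Qed.

Lemma contr_dist_root v : edge T t v ->
  tree_dist (contrT u) (contrT v) <= weight T t u + weight T t v.
Proof.
move=> tv; rewrite /contrT -contr_root; apply: le_trans (contr_dist_edge tv) _.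
rewrite !val_contr eqxx neighbor_neq //; apply: le_trans (tree_dist_triangle _ t _) _.
by rewrite lerD ?tree_dist_edge_le // tree_distC tree_dist_edge_le.
Qed.

(** If one of the two is [u], the walk through [t] shrinks to one edge; if they are distinct and
    both differ from [u], then [tu] has weight zero and the detour through [u] is free. *)
Lemma contr_dist_neighbors v w : edge T t v -> edge T t w ->
  tree_dist (contrT v) (contrT w) <= weight T t v + weight T t w.
Proof.
move=> tv tw; have [->|vu] := eqVneq v u; first exact: contr_dist_root.
have [->|wu] := eqVneq w u; first by rewrite tree_distC addrC contr_dist_root.
have [->|vw] := eqVneq v w; first by rewrite tree_dist0 addr_ge0 ?weight_ge0.
have tu0 := tu_weight tv tw vu wu vw.
apply: le_trans (tree_dist_triangle _ (contrT u) _) _.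
have := contr_dist_root tv; have := contr_dist_root tw.
by rewrite tu0 !add0r [in tree_dist (contrT v) _]tree_distC => wle vle; rewrite lerD.
Qed.

(* A walk starting at the contracted vertex [t] has no counterpart of the same
   weight, only its extensions by an edge [x t] do. *)
Lemma contr_dist_walk v (p : seq T) : path (edge T) v p -> last v p != t ->
  if v == t then forall x, edge T t x ->
    tree_dist (contrT x) (contrT (last v p)) <= weight T t x + walk_weight v p
  else tree_dist (contrT v) (contrT (last v p)) <= walk_weight v p.
Proof.
elim: p v => [|c p IHp] v /=.
  by move=> _ /negPf->; rewrite tree_dist0.
case/andP=> vc cp lt; move: (IHp c cp lt).
have [vE|vt] := eqVneq v t.
  rewrite vE in vc *; rewrite neighbor_neq // => le x tx.
  apply: le_trans (tree_dist_triangle _ (contrT c) _) _.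
  by rewrite addrA lerD // contr_dist_neighbors.
have [cE|ct le] := eqVneq c t.
  rewrite cE in vc *; have tv : edge T t v by rewrite edge_sym.
  by rewrite (weight_sym vc) => /(_ v tv).
apply: le_trans (tree_dist_triangle _ (contrT c) _) _; rewrite lerD //.
apply: le_trans (contr_dist_edge vc) _.
by rewrite !val_contr (negPf vt) (negPf ct) tree_dist_edge_le.
Qed.

(** Walks of [T] project without gaining weight; conversely the weights of the contraction are
    distances of [T], so the triangle inequality bounds its walks from below. *)
Lemma contr_dist (a b : contr_tree) : tree_dist a b = tree_dist (val a) (val b).
Proof.
apply/eqP; rewrite eq_le; apply/andP; split; apply: tree_dist_ge => p.
  move=> ap lb; have := contr_dist_walk ap; rewrite lb (negPf (valP a)).
  by rewrite /contrT !contr_val => /(_ (valP b)).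
elim: p a => [|c p IHp] a /=; first by move=> _ ->; rewrite tree_dist0.
case/andP=> _ cp lb; apply: le_trans (tree_dist_triangle _ (val c) _) _.
by rewrite lerD2l IHp.
Qed.

(** Replacing [t] by [u] in [S] changes no distance to the other vertices: either [u] is at distance
    zero, or every path leaving [t] meets [S] again at its next vertex. *)
Definition contractible (S : {set T}) :=
  t \in S -> weight T t u = 0 \/ forall v, edge T t v -> v \in S.

Lemma contr_closer (S : {set T}) a x : contractible S -> a \in S -> x != t ->
  exists2 b, b \in contrT @: S & tree_dist (val b) x <= tree_dist a x.
Proof.
move=> SC aS xt; have [aE|at'] := eqVneq a t; last first.
  by exists (contr a); rewrite ?imset_f // val_contr (negPf at').
rewrite aE in aS *; have [tu0|tS] := SC aS.
  exists (contr t); rewrite ?imset_f // val_contr eqxx.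
  by rewrite -[leRHS]add0r -tu0 -(tree_dist_edge tu) (tree_distC t) tree_dist_triangle.
have [v tv xv] := branch_ex xt.
exists (contr v); first by rewrite imset_f ?tS.
rewrite val_contr neighbor_neq // (@tree_dist_cut _ _ t v t) ?branch_refl //.
by rewrite tree_dist0 add0r lerDr weight_ge0.
Qed.

Lemma contr_farther (S : {set T}) a x : contractible S -> a \in S ->
  exists2 s, s \in S & tree_dist s x <= tree_dist (val (contr a)) x.
Proof.
move=> SC aS; have [aE|at'] := eqVneq a t; last first.
  by exists a => //; rewrite val_contr (negPf at').
rewrite aE in aS *; rewrite val_contr eqxx; have [tu0|tS] := SC aS.
  exists t => //; rewrite -[leRHS]add0r -tu0 -(tree_dist_edge tu).
  exact: tree_dist_triangle.
by exists u; rewrite ?tS.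
Qed.

Lemma contr_set_dist (S W : {set T}) : S != finset.set0 -> W != finset.set0 ->
  contractible S -> contractible W ->
  set_dist (contrT @: S) (contrT @: W) = set_dist S W.
Proof.
move=> S0 W0 SC WC; apply/eqP; rewrite eq_le; apply/andP; split.
  have [a [b [aS bW ->]]] := set_dist_attained S0 W0.
  (* Only one end is moved, towards an end other than [t], which [contr] fixes; if both ends are
     [t], both distances vanish. *)
  have [bE|bt] := eqVneq b t.
    have [aE|at'] := eqVneq a t.
      rewrite aE bE tree_dist0 -(tree_dist0 (contrT t)).
      by apply: set_dist_le; apply: imset_f; [rewrite -aE | rewrite -bE].
    have [c cW] := contr_closer WC bW at'; rewrite (tree_distC b); apply: le_trans.
    have -> : a = val (contr a) by rewrite val_contr (negPf at').
    by rewrite tree_distC -contr_dist set_dist_le ?imset_f.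
  have [c cS] := contr_closer SC aS bt; apply: le_trans.
  have -> : b = val (contr b) by rewrite val_contr (negPf bt).
  by rewrite -contr_dist set_dist_le ?imset_f.
have S0' : contrT @: S != finset.set0 by rewrite imset_eq0.
have W0' : contrT @: W != finset.set0 by rewrite imset_eq0.
have [_ [_ [/imsetP[a aS ->] /imsetP[b bW ->] ->]]] := set_dist_attained S0' W0'.
rewrite contr_dist; have [s sS] := contr_farther (val (contr b)) SC aS.
apply: le_trans; rewrite tree_distC.
have [w wW] := contr_farther s WC bW; apply: le_trans; rewrite tree_distC.
exact: set_dist_le.
Qed.

Lemma contr_subtree (S : {set T}) : is_subtree S -> is_subtree (contrT @: S).
Proof.
case=> S0 Sc; split; first by rewrite imset_eq0.
move=> _ _ /imsetP[a aS ->] /imsetP[b bS ->]; apply: connect_map (Sc a b aS bS).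
move=> v w /and3P[vS wS vw]; have [|vwN] := eqVneq (contrT v) (contrT w); first by left.
by right; apply/and3P; split; rewrite ?imset_f //; apply: contr_edge_contr.
Qed.

(** The one place where the absence of smaller representations is used; later consequences of it are
    obtained by exhibiting a contractible edge. *)
Lemma contractible_not_minimal (X : finType) (d : X -> X -> R) (phi : X -> {set T}) :
  (forall x, contractible (phi x)) -> ~ minimal_representation d phi.
Proof.
move=> phiC [[phiT dE] []]; exists contr_tree, (fun x => contrT @: phi x).
split; last exact: contr_minor.
split=> [x|x y]; first exact: contr_subtree.
by rewrite contr_set_dist ?dE //; apply: (proj1 (phiT _)).
Qed.

End Contraction.

(** * Separating vertices, bridges and medians in trees with positive weights *)

Section PositiveTree.
Variables (R : realType) (T : weighted_tree R).
Hypothesis weight_gt0 : forall t u, edge T t u -> 0 < weight T t u.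
Implicit Types (s t u v w c : T) (U W A B C : {set T}).

Lemma tree_dist_gt0 t s : s != t -> 0 < tree_dist t s.
Proof.
case/branch_ex => v tv sv; rewrite (@tree_dist_cut _ _ t v) ?branch_refl //.
by rewrite tree_dist0 add0r ltr_pwDl ?weight_gt0 ?tree_dist_ge0.
Qed.

Lemma tree_dist_eq0 t s : tree_dist t s = 0 -> s = t.
Proof.
by move=> ts0; apply/eqP; apply: contraT => /tree_dist_gt0; rewrite ts0 ltxx.
Qed.

Lemma point_dist_eq0 t W : W != finset.set0 -> point_dist t W = 0 -> t \in W.
Proof. by case/(point_dist_attained t) => w wW -> /tree_dist_eq0 <-. Qed.

(** Recovers adjacency from the metric: the first vertex on the way from [t] to [u] always lies
    between them. *)
Lemma edge_between t u : edge T t u <->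
  t != u /\ forall w, tree_dist t w + tree_dist w u = tree_dist t u -> w = t \/ w = u.
Proof.
split=> [tu|[tu between]].
  split=> [|w]; first by apply: contraTneq tu => ->; rewrite edge_irrefl.
  have [wu|] := boolP (w \in branch t u).
    rewrite (@tree_dist_cut _ _ t u t) ?branch_refl // tree_dist0 add0r.
    rewrite (tree_dist_edge tu) (tree_distC w) => eq; right; apply: tree_dist_eq0.
    lra.
  rewrite -in_setC -branch_swap // => wt.
  rewrite (@tree_dist_cut _ _ t u w) ?branch_refl // tree_dist0 addr0.
  rewrite (tree_dist_edge tu) (tree_distC w) => eq; left; apply: tree_dist_eq0.
  lra.
have [|v tv uv] := @branch_ex _ _ t u; first by rewrite eq_sym.
have [||<- //] := between v.
  by rewrite (@tree_dist_cut _ _ t v t u) ?branch_refl // tree_dist0 add0r (tree_dist_edge tv).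
by move=> vt; rewrite vt edge_irrefl in tv.
Qed.

Lemma branch_disjoint t u v : edge T t u -> edge T t v -> u != v ->
  branch t u \subset branch v t.
Proof.
move=> tu tv uv; apply/subsetP => w wu; rewrite branch_swap // in_setC.
by apply: contra uv => wv; apply/eqP; apply: branch_uniq wu wv.
Qed.

(* No branch at [t] meets both [A] and [B]. *)
Definition separates t A B := forall w, edge T t w ->
  A \subset branch w t \/ B \subset branch w t.

(** The lower bounds are triangle inequalities. If [t] is outside [W], the branch holding [W] misses
    [A] or [B], and [t] lies on the bridge from that set to [W], giving equality. *)
Lemma point_dist_separated t A B W :
  A != finset.set0 -> B != finset.set0 -> is_subtree W -> separates t A B ->
  point_dist t W = Num.max 0 (Num.max (set_dist A W - point_dist t A)
                                      (set_dist B W - point_dist t B)).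
Proof.
move=> A0 B0 WT sep; have W0 := proj1 WT; apply/eqP; rewrite eq_le.
apply/andP; split; last first.
  rewrite !ge_max point_dist_ge0 //= !lerBlDl.
  by rewrite !set_dist_triangle.
have [tW|tNW] := boolP (t \in W); first by rewrite point_dist_in // le_max lexx.
have [w tw Ww] := subtree_branch WT tNW.
by have [sub|sub] := sep w tw; rewrite !le_max;
  rewrite (set_dist_through tw _ W0 sub Ww) // addrAC subrr add0r lexx ?orbT.
Qed.

(** The end in [A] of a shortest bridge works: its next vertex [v] is outside [A], being strictly
    closer to [B], so only the branch of [v] meets [B], and [A] misses it. *)
Lemma bridge_end A B : is_subtree A -> is_subtree B -> 0 < set_dist A B ->
  exists t, [/\ point_dist t A = 0, point_dist t B = set_dist A B & separates t A B].
Proof.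
move=> AT BT AB; have [A0 B0] := (proj1 AT, proj1 BT).
have [a [b [aA bB abE]]] := set_dist_attained A0 B0.
have aB : point_dist a B = set_dist A B.
  apply/eqP; rewrite eq_le abE point_dist_le //= -abE.
  by have [c cB ->] := point_dist_attained a B0; apply: set_dist_le.
have aNB : a \notin B by apply: contraTN AB => /point_dist_in; rewrite aB => ->; rewrite ltxx.
have [v av Bv] := subtree_branch BT aNB.
have vNA : v \notin A.
  apply/negP => vA; have := set_dist_triangle v A0 B0.
  rewrite point_dist_in // add0r -aB (@point_dist_cut _ _ a v) //.
  by rewrite gerDr leNgt weight_gt0.
exists a; split=> //; first exact: point_dist_in.
move=> w aw; have [->|wv] := eqVneq w v; [left|right].
  exact: (subtree_side AT av vNA aA (branch_refl v a)).
by apply: subset_trans Bv (branch_disjoint _ _ _) => //; rewrite eq_sym.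
Qed.

Lemma set_dist_two_branches t u v A B : edge T t u -> edge T t v -> u != v ->
  A != finset.set0 -> B != finset.set0 ->
  A \subset branch t u -> B \subset branch t v ->
  set_dist A B = point_dist t A + point_dist t B.
Proof.
move=> tu tv uv A0 B0 Au Bv; apply: (@set_dist_through _ _ t v) => //.
exact: subset_trans Au (branch_disjoint _ _ _).
Qed.

(** A minimizer is a median of the three subtrees. *)
Definition dist_sum A B C t := point_dist t A + point_dist t B + point_dist t C.

(** Moving from [c] to [v] gains the weight of [cv] twice and loses it at most once. *)
Lemma dist_sum_min_branch A B C c v :
  A != finset.set0 -> B != finset.set0 -> C != finset.set0 ->
  (forall t, dist_sum A B C c <= dist_sum A B C t) -> edge T c v ->
  A \subset branch c v -> B \subset branch c v -> False.
Proof.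
move=> A0 B0 C0 /(_ v) min cv Av Bv; move: min; rewrite /dist_sum.
rewrite (@point_dist_cut _ _ c v A) // (@point_dist_cut _ _ c v B) //.
have := point_dist_triangle v c C0.
by rewrite tree_distC tree_dist_edge //; have := weight_gt0 cv; lra.
Qed.

(** If [c] were in [A], then [B] and [C] would lie in branches at [c]: a common one contradicts
    minimality, two different ones the strict triangle inequality. *)
Lemma dist_sum_min_notin A B C c :
  is_subtree A -> is_subtree B -> is_subtree C ->
  (forall t, dist_sum A B C c <= dist_sum A B C t) ->
  0 < set_dist A B -> 0 < set_dist A C ->
  set_dist B C < set_dist A B + set_dist A C -> c \notin A.
Proof.
move=> AT BT CT min AB AC BC; have [A0 B0 C0] := And3 (proj1 AT) (proj1 BT) (proj1 CT).
apply/negP => cA; have := point_dist_in cA.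
have := set_dist_triangle c A0 B0; have := set_dist_triangle c A0 C0 => leAC leAB cA0.
have cB : c \notin B by apply/negP => /point_dist_in; lra.
have cC : c \notin C by apply/negP => /point_dist_in; lra.
have [u cu Bu] := subtree_branch BT cB; have [v cv Cv] := subtree_branch CT cC.
have [uv|uv] := eqVneq u v.
  rewrite -uv in Cv; apply: (@dist_sum_min_branch B C A c u) => // t.
  by have := min t; rewrite /dist_sum; lra.
by have := set_dist_two_branches cu cv uv B0 C0 Bu Cv; lra.
Qed.

(** A median lies outside all three subtrees, and by minimality they occupy three different
    branches, so each pairwise distance passes through it. *)
Lemma tripod A B C : is_subtree A -> is_subtree B -> is_subtree C ->
  0 < set_dist A B -> 0 < set_dist A C -> 0 < set_dist B C ->
  set_dist A B < set_dist A C + set_dist B C ->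
  set_dist A C < set_dist A B + set_dist B C ->
  set_dist B C < set_dist A B + set_dist A C ->
  exists t, [/\ set_dist A B = point_dist t A + point_dist t B,
    set_dist A C = point_dist t A + point_dist t C,
    set_dist B C = point_dist t B + point_dist t C & separates t A B].
Proof.
move=> AT BT CT AB AC BC; have [A0 B0 C0] := And3 (proj1 AT) (proj1 BT) (proj1 CT).
move=> ltAB ltAC ltBC; have /card_gt0P[t0 _] := tree_nonempty T.
case: (@arg_minP _ _ _ t0 predT (dist_sum A B C) isT) => c _ minc.
have min t : dist_sum A B C c <= dist_sum A B C t by apply: minc.
have cA : c \notin A by apply: (@dist_sum_min_notin A B C).
have cB : c \notin B.
  apply: (@dist_sum_min_notin B A C); rewrite // 1?[set_dist B A]set_distC //.
  by move=> t; have := min t; rewrite /dist_sum; lra.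
have cC : c \notin C.
  apply: (@dist_sum_min_notin C A B);
    rewrite // ?[set_dist C A]set_distC ?[set_dist C B]set_distC //.
  by move=> t; have := min t; rewrite /dist_sum; lra.
have [u cu Au] := subtree_branch AT cA.
have [v cv Bv] := subtree_branch BT cB.
have [w cw Cw] := subtree_branch CT cC.
have uv : u != v.
  by apply/eqP => uv; rewrite -uv in Bv; apply: (@dist_sum_min_branch A B C c u).
have uw : u != w.
  apply/eqP => uw; rewrite -uw in Cw; apply: (@dist_sum_min_branch A C B c u) => // t.
  by have := min t; rewrite /dist_sum; lra.
have vw : v != w.
  apply/eqP => vw; rewrite -vw in Cw; apply: (@dist_sum_min_branch B C A c v) => // t.
  by have := min t; rewrite /dist_sum; lra.
exists c; split; last 1 first.
- move=> x cx; have [->|xu] := eqVneq x u; [right|left].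
    by apply: subset_trans Bv (branch_disjoint _ _ _); rewrite // eq_sym.
  by apply: subset_trans Au (branch_disjoint _ _ _); rewrite // eq_sym.
- exact: (set_dist_two_branches cu cv).
- exact: (set_dist_two_branches cu cw).
- exact: (set_dist_two_branches cv cw).
Qed.

End PositiveTree.

(** * Consequences of minimality *)

Section Minimal.
Variables (R : realType) (X : finType) (d : X -> X -> R).
Variables (T : weighted_tree R) (phi : X -> {set T}).
Hypothesis minT : minimal_representation d phi.
Implicit Types (s t u v w : T).

Lemma minimal_subtree x : is_subtree (phi x).
Proof. by case: minT => [[]]. Qed.

Lemma minimal_neq0 x : phi x != finset.set0.
Proof. exact: (proj1 (minimal_subtree x)). Qed.

Lemma minimal_dist x y : d x y = set_dist (phi x) (phi y).
Proof. by case: minT => [[]]. Qed.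

Lemma minimal_weight_gt0 t u : edge T t u -> 0 < weight T t u.
Proof.
move=> tu; rewrite lt_def weight_ge0 // andbT; apply/eqP => tu0.
apply: (contractible_not_minimal tu (fun _ _ _ _ _ _ _ => tu0) _ minT).
by move=> x _; left.
Qed.

(** If every subtree containing [t] contained all neighbours of [t], the edge [tu] could be
    contracted. *)
Lemma minimal_boundary t u : edge T t u ->
  (forall v w, edge T t v -> edge T t w -> v != u -> w != u -> v = w) ->
  exists x v, [/\ t \in phi x, edge T t v & v \notin phi x].
Proof.
move=> tu two.
suff /existsP[x /existsP[v /and3P[]]] :
  [exists x, exists v, [&& t \in phi x, edge T t v & v \notin phi x]] by exists x, v.
apply: contraT => none; case: (contractible_not_minimal tu _ _ minT) => [v w tv tw vu wu|x tx].
  by rewrite (two v w) ?eqxx.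
right=> v tv; apply: contraNT none => vx; apply/existsP; exists x.
by apply/existsP; exists v; rewrite tx tv.
Qed.

(** Moving away from [t] the branches shrink until [v] is a leaf; some subtree then contains [v] but
    not its only neighbour, so it stays on the side of [v]. *)
Lemma minimal_label t v : edge T t v -> exists y, phi y \subset branch t v.
Proof.
have [n] := ubnP #|branch t v|; elim: n t v => // n IHn t v le tv.
have vt : edge T v t by rewrite edge_sym.
have [/existsP[w /andP[vw wt]]|/existsPn none] := boolP [exists w, edge T v w && (w != t)].
  have sub := branch_proper tv vw wt.
  have [|y yw] := IHn v w _ vw; first exact: leq_trans (proper_card sub) _.
  by exists y; apply: subset_trans yw (proper_sub sub).
have only w : edge T v w -> w = t.
  by move=> vw; have := none w; rewrite vw negbK => /eqP.
have [|y [w [vy /only-> tNy]]] := minimal_boundary vt.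
  by move=> a b /only-> /only->.
by exists y; apply: (subtree_side (minimal_subtree y) vt tNy vy (branch_refl t v)).
Qed.

(** A label behind [t] as seen from [s] works, since every path to it passes [t]. *)
Lemma minimal_far s t : s != t ->
  exists y, point_dist s (phi y) = tree_dist s t + point_dist t (phi y).
Proof.
case/branch_ex => v tv sv; have vt : edge T v t by rewrite edge_sym.
have [y yt] := minimal_label vt; exists y; apply/eqP.
rewrite eq_le point_dist_triangle ?minimal_neq0 //=.
have [w wy ->] := point_dist_attained s (minimal_neq0 y).
rewrite (tree_dist_cut vt sv (branch_refl v t)) (tree_dist_cut vt sv (subsetP yt w wy)).
by rewrite tree_dist0 addr0 lerD2l point_dist_le.
Qed.

Lemma minimal_profile_inj s t :
  (forall z, point_dist s (phi z) = point_dist t (phi z)) -> s = t.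
Proof.
move=> st; apply/eqP; apply: contraT => /[dup] /minimal_far[y].
rewrite st -[LHS]add0r => /addIr st0 /(tree_dist_gt0 minimal_weight_gt0).
by rewrite tree_distC -st0 ltxx.
Qed.

Lemma minimal_vertex t u : edge T t u ->
  (exists x v, [/\ t \in phi x, edge T t v & v \notin phi x]) \/
  (exists v w, [/\ edge T t v, edge T t w, v != u, w != u & v != w]).
Proof.
move=> tu; have [/existsP[v /existsP[w /and5P[]]]|none] := boolP
  [exists v, exists w, [&& edge T t v, edge T t w, v != u, w != u & v != w]].
  by right; exists v, w.
left; apply: (minimal_boundary tu) => v w tv tw vu wu; apply/eqP.
apply: contraNT none => vw; apply/existsP; exists v; apply/existsP; exists w.
by rewrite tv tw vu wu vw.
Qed.

End Minimal.

(** * Matching the vertices of two minimal representations *)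

Section TwoMinimal.
Variables (R : realType) (X : finType) (d : X -> X -> R).
Variables (T1 : weighted_tree R) (phi1 : X -> {set T1}).
Variables (T2 : weighted_tree R) (phi2 : X -> {set T2}).
Hypothesis min1 : minimal_representation d phi1.
Hypothesis min2 : minimal_representation d phi2.

Definition same_profile (t1 : T1) (t2 : T2) :=
  forall z, point_dist t1 (phi1 z) = point_dist t2 (phi2 z).

Lemma same_profile_separated t1 t2 x y :
  separates t1 (phi1 x) (phi1 y) -> separates t2 (phi2 x) (phi2 y) ->
  point_dist t1 (phi1 x) = point_dist t2 (phi2 x) ->
  point_dist t1 (phi1 y) = point_dist t2 (phi2 y) ->
  same_profile t1 t2.
Proof.
move=> sep1 sep2 eqx eqy z.
have neq1 := minimal_neq0 min1; have neq2 := minimal_neq0 min2.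
rewrite (point_dist_separated (neq1 x) (neq1 y) (minimal_subtree min1 z) sep1).
rewrite (point_dist_separated (neq2 x) (neq2 y) (minimal_subtree min2 z) sep2).
by rewrite eqx eqy -!(minimal_dist min1) -!(minimal_dist min2).
Qed.

Lemma match_boundary t v x : edge T1 t v -> t \in phi1 x -> v \notin phi1 x ->
  exists t2, same_profile t t2.
Proof.
move=> tv tx vx; have neq1 := minimal_neq0 min1.
have xt := subtree_side (minimal_subtree min1 x) tv vx tx (branch_refl v t).
have [y yv] := minimal_label min1 tv.
have xy : d x y = point_dist t (phi1 y).
  rewrite (minimal_dist min1) (set_dist_through tv (neq1 x) (neq1 y) xt yv).
  by rewrite point_dist_in // add0r.
have xy_gt0 : 0 < set_dist (phi2 x) (phi2 y).
  rewrite -(minimal_dist min2) xy (point_dist_cut tv (neq1 y) yv).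
  by rewrite ltr_pwDl ?point_dist_ge0 ?(minimal_weight_gt0 min1).
have [t2 [t2x t2y sep2]] := bridge_end (minimal_weight_gt0 min2)
  (minimal_subtree min2 x) (minimal_subtree min2 y) xy_gt0.
exists t2; apply: (@same_profile_separated t t2 x y) => //.
- move=> w tw; have [->|wv] := eqVneq w v; [by left|right].
  by apply: subset_trans yv (branch_disjoint _ _ _); rewrite // eq_sym.
- by rewrite t2x point_dist_in.
- by rewrite t2y -(minimal_dist min2).
Qed.

Lemma match_branching t u v w : edge T1 t u -> edge T1 t v -> edge T1 t w ->
  u != v -> u != w -> v != w -> exists t2, same_profile t t2.
Proof.
move=> tu tv tw uv uw vw; have neq1 := minimal_neq0 min1.
have [[x xu] [y yv] [z zw]] :=
  And3 (minimal_label min1 tu) (minimal_label min1 tv) (minimal_label min1 tw).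
have gt0 a s : edge T1 t s -> phi1 a \subset branch t s -> 0 < point_dist t (phi1 a).
  move=> ts sub; rewrite (point_dist_cut ts (neq1 a) sub).
  by rewrite ltr_pwDl ?point_dist_ge0 ?(minimal_weight_gt0 min1).
have := gt0 x u tu xu; have := gt0 y v tv yv; have := gt0 z w tw zw => z0 y0 x0.
have xy := set_dist_two_branches tu tv uv (neq1 x) (neq1 y) xu yv.
have xz := set_dist_two_branches tu tw uw (neq1 x) (neq1 z) xu zw.
have yz := set_dist_two_branches tv tw vw (neq1 y) (neq1 z) yv zw.
move: xy xz yz; rewrite -!(minimal_dist min1) => xy xz yz.
(* The distances from [t] to the three subtrees are positive, which makes all triangle inequalities
   strict. *)
have [||||||t2 []] := tripod (minimal_weight_gt0 min2)
  (minimal_subtree min2 x) (minimal_subtree min2 y) (minimal_subtree min2 z);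
  rewrite -!(minimal_dist min2); try lra.
move=> xy2 xz2 yz2 sep2; exists t2; apply: (@same_profile_separated t t2 x y) => //.
- move=> s ts; have [->|su] := eqVneq s u; [right|left].
    by apply: subset_trans yv (branch_disjoint _ _ _); rewrite // eq_sym.
  by apply: subset_trans xu (branch_disjoint _ _ _); rewrite // eq_sym.
(* In both trees the distance to the subtree of [x] is the Gromov product (d(x,y) + d(x,z) - d(y,z))
   / 2, and similarly for [y]. *)
- lra.
- lra.
Qed.

(** Here [t] is the only vertex, so [d] is nowhere positive. Any [t2] works: a subtree missing it
    would be at positive distance from a label on the other side. *)
Lemma match_isolated t : (forall v, ~~ edge T1 t v) -> exists t2, same_profile t t2.
Proof.
move=> none; have all_in z : t \in phi1 z.
  have /set0Pn[s sz] := minimal_neq0 min1 z.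
  have [<- //|/branch_ex[v tv _]] := eqVneq s t.
  by have := none v; rewrite tv.
have d0 x y : d x y <= 0.
  rewrite (minimal_dist min1) -(tree_dist0 t).
  exact: set_dist_le.
have /card_gt0P[t2 _] := tree_nonempty T2; exists t2 => z.
rewrite point_dist_in // point_dist_in //; apply: contraT => t2z.
have neq2 := minimal_neq0 min2.
have [v tv zv] := subtree_branch (minimal_subtree min2 z) t2z.
have vt : edge T2 v t2 by rewrite edge_sym.
have [y yt] := minimal_label min2 vt; have := d0 y z.
rewrite (minimal_dist min2) (set_dist_cut tv (neq2 y) (neq2 z) yt zv).
rewrite leNgt -addrA ltr_wpDl ?point_dist_ge0 //.
by rewrite ltr_pwDl ?point_dist_ge0 ?(minimal_weight_gt0 min2).
Qed.

Lemma match_vertex t : exists t2, same_profile t t2.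
Proof.
have [/existsP[u tu]|/existsPn] := boolP [exists u, edge T1 t u]; last first.
  exact: match_isolated.
have [[x [v [tx tv vx]]]|[v [w [tv tw vu wu vw]]]] := minimal_vertex min1 tu.
  exact: match_boundary tv tx vx.
by apply: (match_branching tu tv tw); rewrite // eq_sym.
Qed.

(** The left distance is a difference of profile values at a far label, which the triangle
    inequality in the other tree bounds. *)
Lemma same_profile_dist_le s1 t1 s2 t2 : same_profile s1 s2 -> same_profile t1 t2 ->
  tree_dist s1 t1 <= tree_dist s2 t2.
Proof.
move=> s12 t12; have [->|] := eqVneq s1 t1; first by rewrite tree_dist0 tree_dist_ge0.
case/(minimal_far min1) => y; rewrite s12 t12 => eq.
rewrite -(lerD2r (point_dist t2 (phi2 y))) -eq.
by rewrite point_dist_triangle ?(minimal_neq0 min2).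
Qed.

End TwoMinimal.

(** * The matching is an isomorphism *)

Theorem theorem1 (R : realType) (X : finType) (d : X -> X -> R)
    (hd : subtree_distance d)
    (T1 : weighted_tree R) (phi1 : X -> {set T1})
    (T2 : weighted_tree R) (phi2 : X -> {set T2})
    (hmin1 : minimal_representation d phi1)
    (hmin2 : minimal_representation d phi2) :
  representation_iso phi1 phi2.
Proof.
have /fin_all_exists[f fP] := match_vertex hmin1 hmin2.
have /fin_all_exists[g gP] := match_vertex hmin2 hmin1.
have fK : cancel f g.
  by move=> t; apply: (minimal_profile_inj hmin1) => z; rewrite -gP -fP.
have gK : cancel g f.
  by move=> t; apply: (minimal_profile_inj hmin2) => z; rewrite -fP -gP.
have f_dist s t : tree_dist (f s) (f t) = tree_dist s t.
  apply/eqP; rewrite eq_le (same_profile_dist_le hmin1 hmin2) // andbT.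
  by apply: (same_profile_dist_le hmin2 hmin1) => z; rewrite fP.
have f_edge u v : edge T2 (f u) (f v) = edge T1 u v.
  apply/idP/idP => /edge_between.
    case/(_ (minimal_weight_gt0 hmin2)) => uv between.
    apply/(edge_between (minimal_weight_gt0 hmin1)); split.
      by apply: contra uv => /eqP->.
    move=> w eq; have := between (f w); rewrite !f_dist.
    by case/(_ eq) => /(can_inj fK); [left|right].
  case/(_ (minimal_weight_gt0 hmin1)) => uv between.
  apply/(edge_between (minimal_weight_gt0 hmin2)); split.
    by rewrite (can_eq fK).
  move=> w; rewrite -(gK w) !f_dist.
  by case/between => ->; [left|right].
exists f; split=> // [|u v uv|x].
- by exists g.
- by rewrite -(tree_dist_edge uv) -f_dist tree_dist_edge ?f_edge.
(* With positive weights, membership in a subtree means distance zero, which the profile records. *)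
apply/setP => w; rewrite -(gK w) (mem_imset _ _ (can_inj fK)).
apply/idP/idP => /point_dist_in.
  by rewrite -fP => /(point_dist_eq0 (minimal_weight_gt0 hmin1)); apply; apply: minimal_neq0 hmin1 x.
by rewrite fP => /(point_dist_eq0 (minimal_weight_gt0 hmin2)); apply; apply: minimal_neq0 hmin2 x.
Qed.
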